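(* For every $r\ge2$, every online algorithm for the minimum-weight perfect matching problem with recourse $r$ has competitive ratio $\Omega\left(\frac{\log n}{r\log r}\right)$ against an oblivious adversary, even when the input consists of $n$ points on the real line. Here $r$ may depend on $n$.
   Context: Online minimum-weight perfect matching with recourse: points of a metric space arrive one pair at a time; after the $i$-th pair arrives the algorithm must maintain a perfect matching $M_i$ on the first $2i$ points $S_i$, with cost equal to the sum of distances of matched pairs. Recourse $r$ means that in each step (arrival of a pair) at most $r$ edges of the current matching may be deleted. Against an oblivious adversary, the input sequence is fixed in advance (unknown to the algorithm), and the competitive ratio is the smallest $c$ with $\mathbb{E}[\mathrm{Cost}(M_i)]\le c\cdot\mathrm{OPT}(S_i)$ for all $i$, where $\mathrm{OPT}(S_i)$ is the minimum cost of a perfect matching on $S_i$. *)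

(* Defs.v *)
From HB Require Import structures.
From mathcomp Require Import all_boot all_order all_algebra.
From mathcomp Require Import all_classical all_reals all_analysis.
Set Implicit Arguments.
Unset Strict Implicit.
Unset Printing Implicit Defensive.
Import Order.TTheory GRing.Theory Num.Theory.
Import numFieldNormedType.Exports.
Local Open Scope classical_set_scope.
Local Open Scope ring_scope.

(* An input of [n] points on the real line is a map [x : 'I_n -> R]; the
   [i]-th pair (counting from 0) consists of [x (2i)] and [x (2i+1)].  Points
   may coincide, so matchings are matchings of arrival indices, not of
   locations. *)

Definition arrived (n i : nat) : {set 'I_n} := [set k : 'I_n | (k < i.*2)%N]%SET.

Definition perfect_matching (T : finType) (S : {set T}) (M : {set {set T}}) :
    bool :=
  finset.partition M S && [forall e in M, #|e| == 2%N].

Section cost.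
Context {R : realType} {n : nat}.
Implicit Types x : 'I_n -> R.

(* The constraint [j < k] makes each edge [{j, k}] count once. *)
Definition matching_cost x (M : {set {set 'I_n}}) : R :=
  \sum_(j < n) \sum_(k < n | (j < k)%N && ([set j; k]%SET \in M))
    `|x j - x k|.

(* When [2i <= n] this is a minimum over a finite nonempty set. *)
Definition opt_cost x (i : nat) : R :=
  inf [set matching_cost x M | M in
         [set M : {set {set 'I_n}} | perfect_matching (arrived n i) M]].

End cost.

(* A randomized online algorithm for inputs of [n] points, with random source
   [Omega]; [run w x i] is the matching held after the arrival of [i] pairs
   when the input is [x] and the random outcome is [w]. *)
Record online_algorithm (R : realType) (n r : nat) (d : measure_display)
    (Omega : measurableType d) := OnlineAlgorithm {
  run : Omega -> ('I_n -> R) -> nat -> {set {set 'I_n}};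
  run_online : forall w x y i,
    (forall k : 'I_n, (k < i.*2)%N -> x k = y k) -> run w x i = run w y i;
  run_perfect : forall w x i,
    (i.*2 <= n)%N -> perfect_matching (arrived n i) (run w x i);
  run_recourse : forall w x i,
    (i.+1.*2 <= n)%N -> (#|run w x i :\: run w x i.+1| <= r)%N;
  run_measurable : forall x i M, measurable [set w | run w x i = M]
}.

Section competitive_ratio.
Context {R : realType} {n r : nat} {d : measure_display}
  {Omega : measurableType d}.
Variables (P : probability Omega R) (A : online_algorithm R n r Omega).

(* Oblivious adversary: the input [x] is fixed independently of [w]. *)
Definition competitive (rho : R) : Prop :=
  forall (x : 'I_n -> R) (i : nat), (i.*2 <= n)%N ->
    ('E_P[fun w => matching_cost x (run A w x i)] <=
       (rho * opt_cost x i)%:E)%E.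

(* [+oo] when the algorithm is not competitive for any finite ratio. *)
Definition competitive_ratio : \bar R :=
  ereal_inf [set rho%:E | rho in [set rho : R | competitive rho]].

End competitive_ratio.

(* Main.v *)
Require Import Defs.
From mathcomp Require Import all_boot all_order all_algebra.
From mathcomp Require Import all_classical all_reals all_analysis.
From mathcomp Require Import measurable_realfun zify lra.
Import Order.TTheory GRing.Theory Num.Theory.
Import numFieldNormedType.Exports.
Local Open Scope ring_scope.

(* By averaging over inputs, it suffices to give a random input that defeats
   every deterministic algorithm.  Put K = 32 r.  The points arrive in phases
   j = 0, ..., L; in phase j the segment [0, 72 r K^L] is cut into K^(L-j)
   windows, and each window receives one pair, whose second point is at the
   left end or at the middle of the window with equal probability.

   The number of points of an interval that contains the middle, but not the
   left end, depends in parity on the random bit, and so does the number of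
   matching edges that leave the interval.  If the algorithm changes only O(r)
   edges at the window during the phase, the endpoints of the interval can be
   chosen far from all changed points, so one of the two outcomes leaves an edge
   of length at least K^j at the window.  Later phases have so few pairs that
   they delete at most half of these edges, hence every scale
   contributes Omega(K^L) to the expected final cost, for a total of
   Omega(L K^L), whereas the optimum on the segment is at most 72 r K^L. *)

Set Implicit Arguments.
Unset Strict Implicit.
Local Open Scope nat_scope.

(** * Partners in a perfect matching, and parity *)

Definition mate (T : finType) (M : {set {set T}}) (p : T) : T :=
  odflt p [pick k | (k != p) && ([set p; k]%SET \in M)].

Lemma mateE (T : finType) (S : {set T}) (M : {set {set T}}) (p q : T) :
  perfect_matching S M -> p != q -> [set p; q]%SET \in M -> mate M p = q.
Proof.
case/andP=> /and3P[_ tM _] _ neq_pq pqM; rewrite /mate; case: pickP => [k|] /=.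
  case/andP=> neq_kp pkM.
  have : [set p; k]%SET = [set p; q]%SET.
    by rewrite -(finset.def_pblock tM pkM (set21 p k)) -(finset.def_pblock tM pqM (set21 p q)).
  move/setP/(_ k); rewrite !inE eqxx orbT (negbTE neq_kp) /=.
  by move/esym/eqP.
by move/(_ q); rewrite eq_sym neq_pq pqM.
Qed.

Lemma mateP (T : finType) (S : {set T}) (M : {set {set T}}) (p : T) :
  perfect_matching S M -> p \in S ->
  mate M p != p /\ [set p; mate M p]%SET \in M.
Proof.
move=> pm pS; case/andP: (pm) => /and3P[/eqP cM tM _] /forall_inP card2.
have pc : p \in finset.cover M by rewrite cM.
have eM := finset.pblock_mem pc; have pe : p \in finset.pblock M p by rewrite finset.mem_pblock.
have /cards2P[a [b [neq_ab abE]]] := card2 _ eM.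
have [q neq_pq pqM] : exists2 q, p != q & [set p; q]%SET \in M.
  move: pe eM; rewrite abE !inE => /orP[]/eqP->; first by exists b.
  by exists a; rewrite 1?eq_sym // finset.setUC.
by rewrite (mateE pm neq_pq pqM) eq_sym.
Qed.

Lemma mate_in (T : finType) (S : {set T}) (M : {set {set T}}) (p : T) :
  perfect_matching S M -> p \in S -> mate M p \in S.
Proof.
move=> pm pS; have [_ eM] := mateP pm pS.
case/andP: (pm) => /and3P[/eqP <- _ _] _.
by apply/finset.bigcupP; exists [set p; mate M p]%SET; rewrite // set22.
Qed.

Lemma mateK (T : finType) (S : {set T}) (M : {set {set T}}) (p : T) :
  perfect_matching S M -> p \in S -> mate M (mate M p) = p.
Proof.
move=> pm pS; have [neq eM] := mateP pm pS.
by apply: (mateE pm neq); rewrite finset.setUC.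
Qed.

(** The default value in [mate] gives unmatched points length zero, so sums of edge lengths may
    range over all points. *)
Lemma mate_out (T : finType) (S : {set T}) (M : {set {set T}}) (p : T) :
  perfect_matching S M -> p \notin S -> mate M p = p.
Proof.
move=> pm; rewrite /mate; case: pickP => //= k /andP[_ eM].
case/andP: (pm) => /and3P[/eqP <- _ _] _ /negP[].
by apply/finset.bigcupP; exists [set p; k]%SET; rewrite // set21.
Qed.

(** The orbits of a fixed-point-free involution have two elements; the induction removes one orbit
    at a time. *)
Lemma odd_card_involution (T : finType) (f : T -> T) (A : {set T}) :
  (forall p, p \in A -> [/\ f p \in A, f p != p & f (f p) = p]) -> ~~ odd #|A|.
Proof.
have [c] := ubnP #|A|; elim: c A => // c IH A ltAc fA.
have [->|[p pA]] := set_0Vmem A; first by rewrite cards0.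
have [fpA neq_fp fK] := fA p pA.
have cA : #|A| = (#|A :\ p :\ f p|).+2.
  by rewrite (cardsD1 p) pA (cardsD1 (f p)) !inE neq_fp fpA.
rewrite cA /= negbK; apply: IH; first by rewrite cA in ltAc; lia.
move=> q; rewrite !inE => /and3P[qfp qp qA].
have [fqA neq_fq fqK] := fA q qA; split=> //.
rewrite fqA andbT.
by apply/andP; split; apply/eqP => e; [case/eqP: qp | case/eqP: qfp];
  rewrite -fqK e // fK.
Qed.

(** [mate M] pairs off the points of [A] whose partner is in [A], so only the others affect the
    parity. *)
Lemma odd_card_leaving (T : finType) (S A : {set T}) (M : {set {set T}}) :
  perfect_matching S M -> A \subset S ->
  odd #|A| = odd #|[set p in A | mate M p \notin A]%SET|.
Proof.
move=> pm /fintype.subsetP AS.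
rewrite -(cardsID [set p | mate M p \in A]%SET A) oddD.
rewrite (negbTE (@odd_card_involution _ (mate M) _ _)) ?addFb; last first.
  move=> p; rewrite !inE => /andP[pA mA]; have pS := AS _ pA.
  have [neq _] := mateP pm pS.
  by rewrite mA (mateK pm pS) neq pA.
by congr odd; apply: eq_card => p; rewrite !inE andbC.
Qed.

(** * Parity coupling of two inputs *)

Definition natdist (a b : nat) : nat := (a - b) + (b - a).

(** Pigeonhole: each point of [D] rules out at most one of the [Q] cells of length [l.*2], and there
    are more cells than points. A point below [c] rules out cell 0, by truncated subtraction, which
    is harmless. *)
Lemma far_threshold (T : finType) (D : {set T}) (f : T -> nat) (c l Q : nat) :
  #|D| < Q -> 0 < l ->
  exists2 s, s < Q & forall p, p \in D ->
    f p < c + s * l.*2 \/ c + s * l.*2 + l.*2 <= f p.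
Proof.
move=> DQ l0.
have: ~ forall s : 'I_Q, val s \in [seq (f p - c) %/ l.*2 | p <- enum D].
  move=> allQ; suff: Q <= #|D| by rewrite leqNgt DQ.
  have: {subset iota 0 Q <= [seq (f p - c) %/ l.*2 | p <- enum D]}.
    by move=> s; rewrite mem_iota add0n => /andP[_ sQ]; apply: (allQ (Ordinal sQ)).
  move/(uniq_leq_size (iota_uniq 0 Q)); rewrite size_iota size_map.
  by rewrite -cardE.
move/existsNP => [s /negP sN]; exists (val s) => [|p pD]; first exact: ltn_ord.
have neq : (f p - c) %/ l.*2 != s.
  apply: contra sN => /eqP e; rewrite [val s](esym e).
  by apply: (map_f (fun p => (f p - c) %/ l.*2)); rewrite mem_enum.
have l2 : 0 < l.*2 by rewrite double_gt0.
case: (ltnP (f p) (c + s * l.*2)); [by left | right].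
have : s * l.*2 <= f p - c by lia.
rewrite -leq_divRL // leq_eqVlt eq_sym (negbTE neq) /=.
rewrite leq_divRL // mulSn; lia.
Qed.

(* Flipping the position of [k0] across the window changes the parity of the
   number of points between two thresholds, hence also the number of edges
   leaving that interval; but short edges at points far from the thresholds
   never leave it, and the edges at the other points are unchanged. *)
Lemma coupling_long_edge (n a l Q : nat) (S D : {set 'I_n})
    (x y : 'I_n -> nat) (M M' : {set {set 'I_n}}) (k0 : 'I_n) :
  perfect_matching S M -> perfect_matching S M' -> 0 < l -> k0 \in S ->
  (forall k, k != k0 -> x k = y k) -> x k0 = a -> y k0 = a + Q * l.*2 ->
  #|D| < Q ->
  (forall p, p \in S -> p != k0 -> p \notin D ->
     a <= x p < a + Q * l.*2 + Q * l.*2 ->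
     mate M p = mate M' p /\ mate M p != k0) ->
  exists p, p \in S /\
    ((a <= x p < a + Q * l.*2 + Q * l.*2) && (l <= natdist (x p) (x (mate M p)))
  || (a <= y p < a + Q * l.*2 + Q * l.*2) && (l <= natdist (y p) (y (mate M' p)))).
Proof.
move=> pm pm' l0 k0S xy xk0 yk0 DQ same.
apply: contrapT => /forallNP none.
have [s sQ sD] := far_threshold y (a) DQ l0.
have [s' sQ' sD'] := far_threshold y (a + Q * l.*2) DQ l0.
have sl : s * l.*2 + l.*2 <= Q * l.*2 by rewrite addnC -mulSn leq_mul2r sQ orbT.
have sl' : s' * l.*2 + l.*2 <= Q * l.*2 by rewrite addnC -mulSn leq_mul2r sQ' orbT.
(* The thresholds are midpoints of two free cells, one in each half of the window: under [y], the
   points of [D] and [k0] stay at distance at least [l] from both, while [x k0] lies to the left of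
   [t]. *)
pose t := a + s * l.*2 + l; pose t' := a + Q * l.*2 + s' * l.*2 + l.
pose A := [set p in S | t <= x p < t']%SET.
pose A' := [set p in S | t <= y p < t']%SET.
have AE : A = (A' :\ k0)%SET.
  apply/setP => p; rewrite !inE; have [->|/xy ->] := eqVneq p k0; rewrite //=.
  by rewrite xk0 /t k0S /=; apply/negP; lia.
have cA : #|A'| = #|A|.+1.
  by rewrite AE (cardsD1 k0) inE k0S yk0 /t /t' /=; rewrite (_ : _ && _ = true) //; lia.
have lA : [set p in A | mate M p \notin A]%SET = [set p in A' | mate M' p \notin A']%SET.
  apply/setP => p; rewrite inE [RHS]inE.
  have [->|pk0] := eqVneq p k0.
    rewrite AE !inE eqxx /= k0S; apply/esym/negP => /andP[_]; rewrite (mate_in pm' k0S) /=.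
    have /not_andP[//|] := none k0.
    by move/negP; rewrite negb_or => /andP[_]; rewrite yk0 /natdist /t /t'; lia.
  have -> : (p \in A') = (p \in A) by rewrite AE in_setD1 pk0.
  have [pA|//] := boolP (p \in A); rewrite /=.
  have pS : p \in S by move: pA; rewrite inE => /andP[].
  have pt : t <= y p < t' by move: pA; rewrite inE pS xy.
  have pw : a <= x p < a + Q * l.*2 + Q * l.*2 by move: pt; rewrite /t /t' xy //; lia.
  have [pD|pD] := boolP (p \in D).
    have /not_andP[//|/negP] := none p; rewrite negb_or pw -(xy p) // pw /= -!ltnNge (xy p pk0).
    have -> : mate M p \in A = (mate M p != k0) && (mate M p \in A') by rewrite AE in_setD1.
    move=> /andP[d1 d2]; rewrite !inE (mate_in pm pS) (mate_in pm' pS) /=.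
    have [{}sD|{}sD] := sD p pD; first by move: pt; rewrite /t; lia.
    have [{}sD'|{}sD'] := sD' p pD; last by move: pt; rewrite /t'; lia.
    have -> : t <= y (mate M' p) < t' by move: d2; rewrite /natdist /t /t'; lia.
    (* A point of [D] in the interval is at least [l.*2] to the right of [a], so a short edge cannot
       join it to [k0]. *)
    have neq : mate M p != k0.
      by apply/eqP => e; move: d1; rewrite e xk0 /natdist; lia.
    by rewrite neq; move: d1; rewrite xy // /natdist /t /t'; lia.
  have [e neq] := same p pS pk0 pD pw.
  by rewrite AE -e in_setD1 neq.
have sA : A \subset S by apply/fintype.subsetP => p; rewrite inE => /andP[].
have sA' : A' \subset S by apply/fintype.subsetP => p; rewrite inE => /andP[].
(* The two sets differ by one point but have the same leaving points, so the parities clash. *)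
have := odd_card_leaving pm sA; rewrite lA -(odd_card_leaving pm' sA') cA /=.
by case: odd.
Qed.

(** * Points affected by deletions *)

Definition changed (T : finType) (M M' : {set {set T}}) : {set T} :=
  [set p | (mate M p != p) && ([set p; mate M p]%SET \notin M')]%SET.

(** A changed point is an endpoint of a deleted edge, and every edge has two endpoints. *)
Lemma card_changed (T : finType) (S : {set T}) (M M' : {set {set T}}) :
  perfect_matching S M -> #|changed M M'| <= #|M :\: M'|.*2.
Proof.
move=> pm; apply: (@leq_trans #|finset.cover (M :\: M')|).
  apply/subset_leq_card/fintype.subsetP => p; rewrite inE => /andP[neq e].
  apply/finset.bigcupP; exists [set p; mate M p]%SET; rewrite ?set21 // finset.in_setD e.
  have [pS|pS] := boolP (p \in S); first by have [] := mateP pm pS.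
  by rewrite (mate_out pm pS) eqxx in neq.
apply: (leq_trans (leq_card_cover _)).
apply: (@leq_trans (\sum_(e in M :\: M') 2)); last by rewrite sum_nat_const muln2.
apply: leq_sum => e; rewrite finset.in_setD => /andP[_ eM].
by case/andP: pm => _ /forall_inP/(_ e eM)/eqP->.
Qed.

Lemma mate_unchanged (T : finType) (S S' : {set T}) (M M' : {set {set T}}) p :
  perfect_matching S M -> perfect_matching S' M' ->
  p \in S -> p \notin changed M M' -> mate M' p = mate M p.
Proof.
move=> pm pm' pS; have [neq _] := mateP pm pS.
rewrite inE neq /= negbK => e; apply: (mateE pm' _ e); by rewrite eq_sym.
Qed.

(** The fibres are disjoint; values of at least [m] are dropped, hence only an inequality. With [f]
    a window index, this bounds a count over windows by a count over points. *)
Lemma sum_card_fibers (T : finType) (A : {set T}) (f : T -> nat) m :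
  \sum_(q < m) #|[set p in A | f p == q]%SET| <= #|A|.
Proof.
under eq_bigr => q _ do rewrite -sum1_card.
rewrite -sum1_card; under eq_bigr => q _ do
  (rewrite (eq_bigl (fun p => (p \in A) && (f p == q))); last by (move=> p; rewrite inE)).
under eq_bigr => q _ do rewrite big_mkcondr.
rewrite exchange_big leq_sum //= => p _.
have [fp|fp] := ltnP (f p) m; last first.
  by rewrite big1 // => q _; case: eqP => // e; move: fp (ltn_ord q); lia.
rewrite (bigD1 (Ordinal fp)) //= eqxx big1 // => q neq; case: eqP => // e.
by case/eqP: neq; apply/val_inj.
Qed.

(* In phase [j] the line is cut into [num_windows j] windows of width [width j],
   and one pair arrives per window: its first point at the left end of the
   window, and its second point (of odd index) there or, if its random bit is
   set, at the middle of the window. *)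
Section schedule.
Variables (n r L : nat).
Hypothesis r_gt0 : 0 < r.

Definition num_windows j := (32 * r) ^ (L - j).
Definition scale j := (32 * r) ^ j.
(** Half a window holds [18 * r] cells of length [(scale j).*2], more than the [16 * r + 1] points
    that the parity coupling may have to avoid. *)
Definition shift j := 18 * r * (scale j).*2.
Definition width j := (shift j).*2.
Definition phase_start j := \sum_(i < j) num_windows i.

(* Junk value [0] for a pair arriving after the last phase. *)
Definition phase i : nat :=
  oapp val 0 [pick j : 'I_L.+1 | phase_start j <= i < phase_start j.+1].

Definition position (u : {ffun 'I_n -> bool}) (k : 'I_n) : nat :=
  let j := phase k./2 in
  (k./2 - phase_start j) * width j + (odd k && u k) * shift j.

(** * Arithmetic of the schedule *)

Lemma scale_gt0 j : 0 < scale j. Proof. by rewrite expn_gt0; lia. Qed.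

Lemma num_windows_gt0 j : 0 < num_windows j. Proof. by rewrite expn_gt0; lia. Qed.

Lemma shift_gt0 j : 0 < shift j.
Proof. by rewrite !muln_gt0 double_gt0 scale_gt0 r_gt0. Qed.

Lemma width_gt0 j : 0 < width j. Proof. by rewrite double_gt0 shift_gt0. Qed.

Lemma phase_startS j : phase_start j.+1 = phase_start j + num_windows j.
Proof. by rewrite /phase_start big_ord_recr. Qed.

Lemma phase_start_le j j' : j <= j' -> phase_start j <= phase_start j'.
Proof.
elim: j' => [|j' IH]; first by rewrite leqn0 => /eqP->.
rewrite leq_eqVlt => /orP[/eqP-> //|/IH h].
by rewrite (leq_trans h) // phase_startS leq_addr.
Qed.

Lemma phaseE i j : j <= L -> phase_start j <= i < phase_start j.+1 -> phase i = j.
Proof.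
move=> jL ij; rewrite /phase; case: pickP => [j' ij'|]; last first.
  by move/(_ (Ordinal (jL : j < L.+1))); rewrite ij.
rewrite /=; case: (ltngtP j' j) => // h.
  by have := phase_start_le h; lia.
by have := phase_start_le h; lia.
Qed.

Lemma positionE u (k : 'I_n) j q : j <= L -> q < num_windows j ->
  k./2 = phase_start j + q ->
  position u k = q * width j + (odd k && u k) * shift j.
Proof.
move=> jL qm kE; rewrite /position (@phaseE _ j) // kE ?addKn //.
by rewrite leq_addr phase_startS ltn_add2l.
Qed.

Lemma position_window u (k : 'I_n) j q : j <= L -> q < num_windows j ->
  k./2 = phase_start j + q -> position u k %/ width j = q.
Proof.
move=> jL qm kE; rewrite (positionE u jL qm kE) divnMDl ?width_gt0 //.
rewrite divn_small ?addn0 // /width; have := shift_gt0 j.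
by case: (_ && _); lia.
Qed.

(** The window counts decrease geometrically by the factor [32 * r], so those from phase [j] on sum
    to at most twice the first. *)
Lemma phase_start_end j : j <= L ->
  phase_start L.+1 <= phase_start j + (num_windows j).*2.
Proof.
move=> jL; have [d dE] : exists d, d = L - j by exists (L - j).
elim: d j jL dE => [|d IH] j jL dE.
  have -> : j = L by lia.
  by rewrite phase_startS; lia.
have numE : num_windows j = 32 * r * num_windows j.+1.
  by rewrite /num_windows -expnS; congr (_ ^ _); lia.
apply: (leq_trans (IH j.+1 _ _)); [lia | lia |].
rewrite phase_startS -addnA leq_add2l -!mul2n numE; nia.
Qed.

(** The deletions after phase [j] thus affect at most an eighth as many points as phase [j] has
    windows. The 32 in the ratio of the phases is this 8, times 2 endpoints per edge, times 2 from
    the geometric series. *)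
Lemma phase_start_gap j : j <= L ->
  8 * ((r * (phase_start L.+1 - phase_start j.+1)).*2) <= num_windows j.
Proof.
rewrite leq_eqVlt => /orP[/eqP->|jL]; first by rewrite subnn muln0.
have := phase_start_end jL.
have -> : num_windows j = 32 * r * num_windows j.+1.
  by rewrite /num_windows -expnS; congr (_ ^ _); lia.
set x := num_windows _; set y := phase_start _; set z := phase_start _ => h.
have : y - z <= x.*2 by lia.
move: (y - z) => t; rewrite -!mul2n; nia.
Qed.

(** Each phase covers the same segment, as the number of windows times their width does not depend
    on the phase; the induction finds the phase of [k]. *)
Lemma position_le u (k : 'I_n) :
  k < (phase_start L.+1).*2 -> position u k <= 72 * r * scale L.
Proof.
move=> kL; have [N [NL]] : exists N, [/\ N <= L.+1 & k./2 < phase_start N].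
  by exists L.+1; split=> //; have := odd_double_half k; lia.
elim: N NL => [|j IH] jL; first by rewrite /phase_start big_ord0.
move=> kj; have [kj'|jk] := ltnP k./2 (phase_start j); first exact: IH (ltnW jL) kj'.
rewrite phase_startS in kj; have qm : k./2 - phase_start j < num_windows j by lia.
rewrite (positionE u _ qm) ?subnKC //.
have -> : 72 * r * scale L = num_windows j * width j.
  rewrite /width /shift -!mul2n /num_windows /scale -(subnKC (jL : j <= L)) expnD.
  by rewrite addKn; nia.
apply: (@leq_trans ((k./2 - phase_start j).+1 * width j)); last by rewrite leq_mul2r qm orbT.
rewrite mulSn addnC leq_add2r /width; case: (_ && _); lia.
Qed.

(** * A deterministic algorithm run on the schedule, and its long edges *)

Variable M : {ffun 'I_n -> bool} -> nat -> {set {set 'I_n}}.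
Hypothesis M_online : forall u v i,
  (forall k : 'I_n, k < i.*2 -> position u k = position v k) -> M u i = M v i.
Hypothesis M_perfect : forall u i, i.*2 <= n -> perfect_matching (arrived n i) (M u i).
Hypothesis M_recourse : forall u i, i.+1.*2 <= n -> #|M u i :\: M u i.+1| <= r.
Hypothesis fits : (phase_start L.+1).*2 <= n.

Lemma M_recourse_add u i d : (i + d).*2 <= n -> #|M u i :\: M u (i + d)| <= r * d.
Proof.
elim: d => [|d IH]; first by rewrite addn0 finset.setDv cards0.
move=> h; have h' : (i + d).*2 <= n by lia.
apply: (@leq_trans #|(M u i :\: M u (i + d)) :|: (M u (i + d) :\: M u (i + d.+1))|).
  apply/subset_leq_card/fintype.subsetP => e; rewrite !inE.
  by case: (e \in M u (i + d)) => /=; rewrite ?orbF // => /andP[h1 h2]; rewrite h1 ?h2.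
apply: (leq_trans (leq_card_setU _ _)); rewrite mulnS addnC leq_add ?IH //.
by rewrite addnS M_recourse // -addnS.
Qed.

(** A window is a region of the line here: [p] may have arrived in any phase, so the definition also
    makes sense for later matchings. *)
Definition long_edge_at j u (N : {set {set 'I_n}}) q :=
  [exists p, (position u p %/ width j == q) &&
     (scale j <= natdist (position u p) (position u (mate N p)))].

Definition stirred j u q :=
  8 * r < #|[set p in changed (M u (phase_start j)) (M u (phase_start j.+1)) |
     position u p %/ width j == q]%SET|.

Definition flip (k : 'I_n) (u : {ffun 'I_n -> bool}) : {ffun 'I_n -> bool} :=
  [ffun i => if i == k then ~~ u i else u i].

Lemma flipK k : involutive (flip k).
Proof. by move=> u; apply/ffunP => i; rewrite !ffunE; case: eqP => // _; rewrite negbK. Qed.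

(** The half-width is left unfolded to match [Q * l.*2] in [coupling_long_edge], with [18 * r] for
    [Q] and [scale j] for [l]. *)
Lemma window_bounds j q x :
  (x %/ width j == q) =
  (q * width j <= x < q * width j + 18 * r * (scale j).*2 + 18 * r * (scale j).*2).
Proof.
rewrite -/(shift j) -addnA addnn -/(width j).
apply/eqP/idP => [<-|/andP[h1 h2]].
  by rewrite leq_trunc_div /= addnC -mulSn ltn_ceil // width_gt0.
apply/eqP; rewrite eqn_leq leq_divRL ?width_gt0 // h1 andbT -ltnS ltn_divLR ?width_gt0 //.
by rewrite mulSn addnC.
Qed.

(** The bit of [k] is revealed only during phase [j], so both inputs enter the phase with the same
    matching. If neither run stirs the window, few of its points change edges and
    [coupling_long_edge] applies. *)
Lemma flip_dichotomy j u q (k : 'I_n) : j <= L -> q < num_windows j ->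
  k = (phase_start j + q).*2.+1 :> nat ->
  [|| stirred j u q, stirred j (flip k u) q,
      long_edge_at j u (M u (phase_start j.+1)) q
    | long_edge_at j (flip k u) (M (flip k u) (phase_start j.+1)) q].
Proof.
move=> jL qm kE; wlog uk : u / u k = false.
  case uk: (u k); last exact.
  move/(_ (flip k u)); rewrite flipK ffunE eqxx uk => /(_ erefl).
  by case/or4P => ->; rewrite ?orbT.
set v := flip k u.
have vk : v k = true by rewrite ffunE eqxx uk.
set T0 := phase_start j; set T1 := phase_start j.+1.
have T1E : T1 = T0 + num_windows j by exact: phase_startS.
have T1n : T1.*2 <= n.
  by rewrite (leq_trans _ fits) // leq_double phase_start_le.
have T0n : T0.*2 <= n by rewrite (leq_trans _ T1n) // leq_double T1E leq_addr.
have k2 : k./2 = T0 + q by rewrite kE /= uphalf_double.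
have ok : odd k by rewrite kE /= odd_double.
have uv i : i != k -> position u i = position v i.
  by move=> ik; rewrite /position ffunE (negbTE ik).
have M0 : M v T0 = M u T0.
  apply: M_online => i iT; rewrite uv //; apply/eqP => e; move: iT.
  by rewrite e kE ltnNge leqW // leq_double leq_addr.
have pmu := M_perfect u T1n; have pmv := M_perfect v T1n.
have pm0 := M_perfect u T0n.
case: (boolP (stirred j u q)) => //= su; case: (boolP (stirred j v q)) => //= sv.
have kn : (T0 + q).*2 < n by have := ltn_ord k; rewrite kE => /ltnW.
(* The companion of [k] in its pair has no edge before the phase, so it is put into [D] together
   with the changed points. *)
pose k1 := Ordinal kn.
have k12 : k1./2 = T0 + q by rewrite /= doubleK.
pose Du := [set p in changed (M u T0) (M u T1) | position u p %/ width j == q]%SET.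
pose Dv := [set p in changed (M v T0) (M v T1) | position v p %/ width j == q]%SET.
pose D := (k1 |: (Du :|: Dv))%SET.
have DQ : #|D| < 18 * r.
  have h1 := leq_of_leqif (leq_card_setU [set k1]%SET (Du :|: Dv)%SET).
  have h2 := leq_of_leqif (leq_card_setU Du Dv).
  have hu : #|Du| <= 8 * r by move: su; rewrite /stirred -leqNgt.
  have hv : #|Dv| <= 8 * r by move: sv; rewrite /stirred -leqNgt.
  rewrite cards1 -/D in h1; apply: (leq_ltn_trans h1).
  apply: (@leq_ltn_trans (1 + (8 * r + 8 * r))).
    by rewrite leq_add2l (leq_trans h2) // leq_add.
  by move: r_gt0; clear; lia.
have kS : k \in arrived n T1 by rewrite inE kE -doubleS leq_double T1E -addnS leq_add2l.
have xk : position u k = q * width j.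
  by rewrite (positionE u jL qm k2) uk andbF addn0.
have yk : position v k = q * width j + 18 * r * (scale j).*2.
  by rewrite (positionE v jL qm k2) vk ok mul1n.
have same p : p \in arrived n T1 -> p != k -> p \notin D ->
     q * width j <= position u p < q * width j + 18 * r * (scale j).*2 + 18 * r * (scale j).*2 ->
     mate (M u T1) p = mate (M v T1) p /\ mate (M u T1) p != k.
  move=> pS pk pD; rewrite -window_bounds => pq.
  (* Only [k] and [k1] arrive in this window during phase [j], so [p] was there before. *)
  have pT0 : p \in arrived n T0.
    rewrite inE ltnNge; apply/negP => Tp.
    have pT1 : p < T1.*2 by move: pS; rewrite inE.
    have p2 : p./2 = T0 + (p./2 - T0).
      by rewrite subnKC // -(doubleK T0) half_leq.
    have qm' : p./2 - T0 < num_windows j.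
      by by rewrite -(ltn_add2l T0) -p2 -T1E ltn_half_double.
    move: pq; rewrite (position_window u jL qm' p2) => /eqP qE.
    have : p = k \/ p = k1.
      have := odd_double_half p; rewrite p2 qE; case: (odd p) => h; [left|right];
      apply/val_inj; rewrite /= ?kE -h //.
    case=> e; first by rewrite e eqxx in pk.
    by rewrite e !inE eqxx in pD.
  move: pD; rewrite !inE !negb_or -(uv _ pk) pq !andbT => /andP[_ /andP[pu pv]].
  have eu := mate_unchanged pm0 pmu pT0 _; rewrite inE pu in eu.
  have ev := mate_unchanged pm0 pmv pT0 _; rewrite inE -M0 pv M0 in ev.
  rewrite eu // ev //; split=> //.
  (* The partner of [p] dates from before the phase, when [k] had not arrived. *)
  have := mate_in pm0 pT0; rewrite inE => h; apply/eqP => e; move: h.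
  by rewrite e kE ltnNge leqW // leq_double leq_addr.
have [p [_ ]] := coupling_long_edge pmu pmv (scale_gt0 j) kS uv xk yk DQ same.
rewrite -!window_bounds => /orP[] h; apply/orP; [left|right]; by apply/existsP; exists p.
Qed.

(** Markov's inequality: the recourse allows [2 * r] changed points per window on average, and a
    stirred window has more than four times as many. *)
Lemma sum_stirred j u : j <= L ->
  4 * \sum_(q < num_windows j) stirred j u q <= num_windows j.
Proof.
move=> jL; set T0 := phase_start j; set T1 := phase_start j.+1.
have T1n : T1.*2 <= n by rewrite (leq_trans _ fits) // leq_double phase_start_le.
have T1E : T1 = T0 + num_windows j by exact: phase_startS.
have cS : #|changed (M u T0) (M u T1)| <= (r * num_windows j).*2.
  rewrite (leq_trans (card_changed _ (M_perfect u _))) ?leq_double ?T1E ?M_recourse_add // -?T1E //.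
  by lia.
suff : 8 * r * \sum_(q < num_windows j) stirred j u q <= (r * num_windows j).*2.
  move=> h; rewrite -(leq_pmul2l r_gt0); move: h; rewrite -mul2n; clear.
  by move: (bigop _ _ _) => x; move: (num_windows j) => y; lia.
apply: leq_trans cS; apply: leq_trans (sum_card_fibers _ (fun p => position u p %/ width j) (num_windows j)).
rewrite big_distrr leq_sum //= => q _; rewrite /stirred.
case: ltnP; rewrite ?muln0 // muln1; exact: ltnW.
Qed.

(* Averages [flip_dichotomy] over [u]: the two inputs that it compares are
   exchanged by [flip], and at most a quarter of the windows are stirred. *)
Lemma sum_long_edge_phase j : j <= L ->
  #|{ffun 'I_n -> bool}| * num_windows j <=
  4 * \sum_(u : {ffun 'I_n -> bool}) \sum_(q < num_windows j)
        long_edge_at j u (M u (phase_start j.+1)) q.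
Proof.
move=> jL; set m := num_windows j.
pose G := \sum_(u : {ffun 'I_n -> bool}) \sum_(q < m) long_edge_at j u (M u (phase_start j.+1)) q.
pose B := \sum_(u : {ffun 'I_n -> bool}) \sum_(q < m) stirred j u q.
have BE : 4 * B <= #|{ffun 'I_n -> bool}| * m.
  by rewrite -sum_nat_const big_distrr leq_sum //= => u _; exact: sum_stirred.
suff : m * #|{ffun 'I_n -> bool}| <= 2 * B + 2 * G by rewrite -/G mulnC; lia.
rewrite /B /G exchange_big [X in _ + 2 * X]exchange_big !big_distrr -big_split /=.
rewrite -[X in X * _]card_ord -sum_nat_const leq_sum // => q _.
have kn : (phase_start j + q).*2.+1 < n.
  by apply: leq_trans fits; have := phase_start_le (jL : j.+1 <= L.+1);
    rewrite (phase_startS j); have := ltn_ord q; rewrite -/m; lia.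
pose k := Ordinal kn; rewrite !mul2n -!addnn.
(* One copy of each doubled sum is reindexed by [flip k], which produces the four terms of
   [flip_dichotomy] for a single [u]. *)
rewrite [X in X + _ + _](reindex_inj (inv_inj (flipK k))) /=.
rewrite [X in _ + (X + _)](reindex_inj (inv_inj (flipK k))) /=.
rewrite -!big_split -sum1_card leq_sum //= => u _.
have := @flip_dichotomy j u q k jL (ltn_ord q) erefl.
by case: (stirred j u q); case: (stirred j (flip k u) q); case: (long_edge_at j u _ q);
  case: (long_edge_at j (flip k u) _ q).
Qed.

(** A window loses its long edge only if the endpoint witnessing it is changed, and distinct windows
    have distinct witnesses. *)
Lemma sum_long_edge_later j T1 T2 : T1 <= T2 -> T2.*2 <= n ->
  \sum_(u : {ffun 'I_n -> bool}) \sum_(q < num_windows j) long_edge_at j u (M u T1) q <=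
  \sum_(u : {ffun 'I_n -> bool}) \sum_(q < num_windows j) long_edge_at j u (M u T2) q +
  #|{ffun 'I_n -> bool}| * (r * (T2 - T1)).*2.
Proof.
move=> T12 T2n; rewrite -sum_nat_const -big_split leq_sum //= => u _.
have pm1 : perfect_matching (arrived n T1) (M u T1).
  by apply: M_perfect; rewrite (leq_trans _ T2n) // leq_double.
have pm2 : perfect_matching (arrived n T2) (M u T2) by exact: M_perfect.
have cC : #|changed (M u T1) (M u T2)| <= (r * (T2 - T1)).*2.
  rewrite (leq_trans (card_changed _ pm1)) // leq_double.
  by have := @M_recourse_add u T1 (T2 - T1); rewrite subnKC // => ->.
apply: leq_trans (leq_add (leqnn _) cC).
apply: leq_trans (leq_add (leqnn _)
  (sum_card_fibers _ (fun p => position u p %/ width j) (num_windows j))).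
rewrite -big_split leq_sum //= => q _.
case: (boolP (long_edge_at j u (M u T1) q)) => // /existsP[p /andP[pq long]].
have [pC|pC] := boolP (p \in changed (M u T1) (M u T2)).
  by rewrite addnC ltn_addr // card_gt0; apply/finset.set0Pn; exists p; rewrite inE pC pq.
have pS : p \in arrived n T1.
  apply: contraLR long => pS; rewrite (mate_out pm1 pS) /natdist subnn -ltnNge.
  exact: scale_gt0.
have -> : long_edge_at j u (M u T2) q; last by [].
by apply/existsP; exists p; rewrite (mate_unchanged pm1 pm2 pS pC) pq long.
Qed.

(** On average at least a quarter of the windows get a long edge in phase [j]; the later phases
    destroy at most an eighth, so an eighth remains. *)
Lemma sum_long_edge_end j : j <= L ->
  #|{ffun 'I_n -> bool}| * num_windows j <=
  8 * \sum_(u : {ffun 'I_n -> bool}) \sum_(q < num_windows j)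
        long_edge_at j u (M u (phase_start L.+1)) q.
Proof.
move=> jL.
have arith (x m g1 g2 y : nat) :
    8 * y <= m -> g1 <= g2 + x * y -> x * m <= 4 * g1 -> x * m <= 8 * g2.
  move=> h1 h2 h3; have : x * (8 * y) <= x * m by rewrite leq_mul2l h1 orbT.
  by lia.
apply: arith (phase_start_gap jL) _ (sum_long_edge_phase jL).
exact: sum_long_edge_later (phase_start_le (jL : j.+1 <= L.+1)) fits.
Qed.

(* One edge may be long at several scales; the scales form a geometric series. *)
Lemma sum_scale_le x N : \sum_(j < N) (scale j <= x) * scale j <= x.*2.
Proof.
have geo k : \sum_(j < k.+1) scale j <= (scale k).*2.
  elim: k => [|k IH]; first by rewrite big_ord_recl big_ord0 /scale.
  rewrite big_ord_recr /= -[leqRHS]addnn leq_add2r (leq_trans IH) //.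
  by rewrite /scale expnS -mul2n leq_mul2r; apply/orP; right; lia.
elim: N => [|N IH]; first by rewrite big_ord0.
have [h|h] := leqP (scale N) x; last first.
  have -> : \sum_(j < N.+1) (scale j <= x) * scale j = \sum_(j < N) (scale j <= x) * scale j.
    by rewrite big_ord_recr /= (leqNgt (scale N)) h mul0n addn0.
  exact: IH.
apply: (@leq_trans (scale N).*2); last by rewrite leq_double.
apply: leq_trans (geo N); apply: leq_sum => j _.
by case: (scale j <= x); rewrite ?mul1n ?mul0n.
Qed.

(** After exchanging the sums, each point lies in at most one window per scale, so [sum_scale_le]
    charges it at most twice the length of its edge. *)
Lemma sum_long_edge_le_cost u (N : {set {set 'I_n}}) :
  \sum_(j < L.+1) scale j * \sum_(q < num_windows j) long_edge_at j u N q <=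
  (\sum_p natdist (position u p) (position u (mate N p))).*2.
Proof.
pose len p := natdist (position u p) (position u (mate N p)).
rewrite -mul2n big_distrr /=.
apply: (@leq_trans (\sum_p \sum_(j < L.+1) (scale j <= len p) * scale j)); last first.
  by apply: leq_sum => p _; rewrite mul2n sum_scale_le.
rewrite exchange_big leq_sum //= => j _.
rewrite -big_distrl mulnC leq_mul2r /=; apply/orP; right.
apply: (@leq_trans #|[set p | scale j <= len p]%SET|); last first.
  rewrite -sum1_card big_mkcond /=; apply: leq_sum => p _.
  by rewrite inE; case: (scale j <= len p).
apply: leq_trans (sum_card_fibers _ (fun p => position u p %/ width j) (num_windows j)).
apply: leq_sum => q _; case: (boolP (long_edge_at j u N q)) => // /existsP[p /andP[pq long]].
by rewrite card_gt0; apply/finset.set0Pn; exists p; rewrite !inE pq andbT.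
Qed.

(** Since [scale j * num_windows j = scale L], all [L.+1] scales contribute equally; 16 is 8 from
    the surviving windows times 2 from the geometric series. *)
Lemma total_cost_lower_bound :
  #|{ffun 'I_n -> bool}| * (L.+1 * scale L) <=
  16 * \sum_(u : {ffun 'I_n -> bool})
    \sum_p natdist (position u p) (position u (mate (M u (phase_start L.+1)) p)).
Proof.
pose Gj j u := \sum_(q < num_windows j) long_edge_at j u (M u (phase_start L.+1)) q.
apply: (@leq_trans (8 * \sum_(u : {ffun 'I_n -> bool}) \sum_(j < L.+1) scale j * Gj j u)); last first.
  rewrite -[16]/(8 * 2) -mulnA leq_mul2l /= big_distrr leq_sum //= => u _.
  by rewrite mul2n sum_long_edge_le_cost.
rewrite exchange_big big_distrr /= mulnCA -[X in X * _]card_ord -sum_nat_const leq_sum // => j _.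
have jL : j <= L by rewrite -ltnS.
have -> : scale L = scale j * num_windows j by rewrite -expnD subnKC.
by rewrite -big_distrr /= mulnCA [leqRHS]mulnCA leq_mul2l sum_long_edge_end ?orbT.
Qed.

End schedule.

(** * Matching costs and the optimum on a segment *)

Local Open Scope ring_scope.

(** Each edge is counted once from either endpoint. Swapping the indices in one copy of the cost
    turns the constraint [j < k] into [k != j]. *)
Lemma matching_cost_mate (R : realType) (n : nat) (x : 'I_n -> R) (S : {set 'I_n})
    (M : {set {set 'I_n}}) :
  perfect_matching S M ->
  matching_cost x M *+ 2 = \sum_p `|x p - x (mate M p)|.
Proof.
move=> pm; rewrite /matching_cost mulr2n.
under eq_bigr => j _ do rewrite big_mkcond.
rewrite [X in _ + X]exchange_big -big_split /=; apply: eq_bigr => j _.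
rewrite -big_split /=.
transitivity (\sum_(k < n | (k != j) && ([set j; k]%SET \in M)) `|x j - x k|).
  rewrite [RHS]big_mkcond; apply: eq_bigr => k _.
  rewrite [[set k; j]%SET]finset.setUC -val_eqE /=.
  by case: (ltngtP j k) => /= _; rewrite ?addr0 ?add0r // distrC.
have [jS|jS] := boolP (j \in S).
  have [neq eM] := mateP pm jS.
  rewrite (bigD1 (mate M j)) /= ?neq ?eM // big1 ?addr0 // => k /andP[/andP[kj kM]].
  have jk : j != k by rewrite eq_sym.
  by rewrite (mateE pm jk kM) eqxx.
rewrite (mate_out pm jS) subrr normr0 big1 // => k /andP[kj kM].
have jk : j != k by rewrite eq_sym.
by rewrite -[in X in _ - X](mateE pm jk kM) (mate_out pm jS) subrr normr0.
Qed.

Lemma natdistE (R : realType) (a b : nat) : `|a%:R - b%:R| = (natdist a b)%:R :> R.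
Proof.
rewrite /natdist; case: (leqP a b) => ab.
  rewrite (eqP (ab : (a - b == 0)%N)) add0n natrB // distrC ger0_norm //.
  by rewrite subr_ge0 ler_nat.
rewrite (eqP (ltnW ab : (b - a == 0)%N)) addn0 natrB 1?ltnW // ger0_norm //.
by rewrite subr_ge0 ler_nat ltnW.
Qed.

(** Only an inequality, as the edge may already belong to [M]. *)
Lemma matching_cost_setU1 (R : realType) (n : nat) (x : 'I_n -> R) (p q : 'I_n)
    (M : {set {set 'I_n}}) :
  p != q ->
  matching_cost x ([set p; q]%SET |: M) <= `|x p - x q| + matching_cost x M.
Proof.
wlog pq : p q / (p < q)%N.
  move=> h neq; case: (ltngtP p q) => [/h->//|qp|/val_inj e].
    by rewrite distrC (finset.setUC [set p]%SET) h // eq_sym.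
  by rewrite e eqxx in neq.
move=> neq; have -> : `|x p - x q| =
    \sum_(j < n) \sum_(k < n | (j < k)%N && ([set j; k]%SET == [set p; q]%SET)) `|x j - x k|.
  rewrite pair_big_dep (big_pred1 (p, q)) //= => -[j k] /=.
  rewrite xpair_eqE; apply/andP/andP => [[jk /eqP e]|[/eqP-> /eqP->]]; last by rewrite pq.
  have := finset.set21 j k; have := finset.set22 j k; rewrite e !inE.
  case/orP=> /eqP ek /orP[] /eqP ej; move: jk; rewrite ?ek ?ej ?ltnn ?eqxx //.
  by rewrite ltnNge ltnW.
rewrite /matching_cost -big_split ler_sum //= => j _.
rewrite big_mkcond [X in _ <= X + _]big_mkcond [X in _ <= _ + X]big_mkcond -big_split /=.
apply: ler_sum => k _.
rewrite !inE; case: (j < k)%N => /=; last by rewrite addr0.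
by case: (_ == _) => /=; case: (_ \in _) => /=; rewrite ?addr0 ?add0r // lerDl.
Qed.

Lemma perfect_matching_setU1 (T : finType) (p q : T) (S : {set T}) (M : {set {set T}}) :
  p != q -> p \notin S -> q \notin S -> perfect_matching S M ->
  perfect_matching ([set p; q] :|: S)%SET ([set p; q] |: M)%SET.
Proof.
move=> pq pS qS /andP[pM /forall_inP c2]; apply/andP; split.
  apply: partitionU1 => //; first by apply/finset.set0Pn; exists p; rewrite finset.set21.
  rewrite -finset.setI_eq0; apply/eqP/setP => z; rewrite !inE.
  by apply/negP => /andP[/orP[]/eqP-> zS]; [rewrite zS in pS|rewrite zS in qS].
apply/forall_inP => e; rewrite !inE => /orP[/eqP->|/c2//].
by rewrite cards2 pq.
Qed.

(** Greedy matching from the left: join the two leftmost points [p] and [q], and recurse on the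
    segment from [x q] to [hi]; the edges cover essentially disjoint parts of the segment. *)
Lemma line_matching (R : realType) (n : nat) (x : 'I_n -> R) (S : {set 'I_n}) (lo hi : R) :
  ~~ odd #|S| -> lo <= hi -> (forall p, p \in S -> lo <= x p <= hi) ->
  exists M, perfect_matching S M /\ matching_cost x M <= hi - lo.
Proof.
have [c] := ubnP #|S|; elim: c S lo => // c IH S lo Sc oS lohi xS.
have [S0|[p0 p0S]] := finset.set_0Vmem S.
  exists finset.set0; split; last first.
    rewrite /matching_cost big1 ?subr_ge0 // => j _; rewrite big1 // => k.
    by rewrite !inE andbF.
  rewrite S0 /perfect_matching; apply/andP; split.
    by rewrite /finset.partition /finset.cover big_set0 eqxx inE /finset.trivIset /finset.cover !big_set0 cards0 eqxx.
  by apply/forall_inP => e; rewrite inE.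
have [p pS' pmin] := Order.TotalTheory.arg_minP x p0S.
have {pS'}pS : p \in S by [].
have S1 : #|S| = (#|S :\ p|).+1 by rewrite (cardsD1 p) pS.
have [S10|[q0 q0S]] := finset.set_0Vmem (S :\ p).
  by rewrite S1 S10 cards0 in oS.
have [q qS' qmin] := Order.TotalTheory.arg_minP x q0S.
have {qS'}qS : q \in S :\ p by [].
have S2 : #|S :\ p| = (#|S :\ p :\ q|).+1 by rewrite (cardsD1 q) qS.
have /andP[qp qS'] : (q != p) && (q \in S) by move: qS; rewrite !inE.
have /andP[lop php] := xS p pS; have /andP[loq qhi] := xS q qS'.
have [||p' p'S|M [pmM cM]] := IH (S :\ p :\ q) (x q) _ _ qhi.
- by rewrite S1 S2 ltnS in Sc; exact: ltnW.
- by move: oS; rewrite S1 S2 /= negbK.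
- move: p'S; rewrite finset.in_setD1 => /andP[_ p'S].
  rewrite qmin //=; move: p'S; rewrite finset.in_setD1 => /andP[_ /xS/andP[_ ->]].
  by [].
have SE : S = ([set p; q] :|: (S :\ p :\ q))%SET.
  by rewrite -finset.setUA !finset.setD1K.
exists ([set p; q] |: M)%SET; split.
  by rewrite SE; apply: perfect_matching_setU1; rewrite ?inE ?eqxx ?andbF // eq_sym.
rewrite (le_trans (matching_cost_setU1 _ _ _)) 1?eq_sym //.
rewrite distrC ger0_norm ?subr_ge0 ?pmin // -addrA.
by rewrite (le_trans (lerD (lexx _) (lerD (lexx _) cM))) // addrC; lra.
Qed.

Lemma card_arrived (n i : nat) : (i.*2 <= n)%N -> #|arrived n i| = i.*2.
Proof.
move=> h; rewrite -sum1_card (eq_bigl (fun k : 'I_n => (k < i.*2)%N)).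
  by rewrite -(big_ord_widen n (fun _ => 1%N)) // sum_nat_const card_ord muln1.
by move=> k; rewrite inE.
Qed.

Lemma matching_cost_ge0 (R : realType) (n : nat) (x : 'I_n -> R) M : 0 <= matching_cost x M.
Proof. by apply: sumr_ge0 => j _; apply: sumr_ge0. Qed.

Lemma opt_cost_bounds (R : realType) (n i : nat) (x : 'I_n -> R) (b : R) :
  (i.*2 <= n)%N -> 0 <= b ->
  (forall p : 'I_n, (p < i.*2)%N -> 0 <= x p <= b) -> 0 <= opt_cost x i <= b.
Proof.
move=> h b0 xb.
have [|p|M [pmM cM]] := @line_matching R n x (arrived n i) 0 b _ b0.
- by rewrite card_arrived // odd_double.
- by rewrite inE; exact: xb.
rewrite subr0 in cM; apply/andP; split.
  apply: lb_le_inf; first by exists (matching_cost x M), M.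
  by move=> _ [N _ <-]; exact: matching_cost_ge0.
apply: (le_trans _ cM); apply: ge_inf; last by exists M.
by exists 0 => _ [N _ <-]; exact: matching_cost_ge0.
Qed.

(** * Averaging over inputs, and the competitive ratio *)

Lemma measurable_run (R : realType) (n r : nat) (d : measure_display)
    (Omega : measurableType d) (A : online_algorithm R n r Omega)
    (x : 'I_n -> R) (i : nat) (f : {set {set 'I_n}} -> R) :
  measurable_fun setT (fun w => f (run A w x i)).
Proof.
move=> _ Y _; rewrite setTI.
(* There are finitely many matchings, so any preimage is a finite union of fibres of [run]. *)
have -> : ((fun w => f (run A w x i)) @^-1` Y)%classic =
    (\bigcup_(N in [set N | Y (f N)]%classic) [set w | run A w x i = N])%classic.
  by apply/seteqP; split => [w Yw|w [N YN]] /=; [exists (run A w x i)|move->].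
apply: fin_bigcup_measurable => [|N _]; first exact: finite_finset.
exact: run_measurable.
Qed.

(** The averaging direction of Yao's principle: the competitive inequality is summed over the family
    of inputs and the sum is moved inside the expectation, where the bound holds for every outcome
    [w]. *)
Lemma competitive_lower_bound (R : realType) (n r : nat) (d : measure_display)
    (Omega : measurableType d) (P : probability Omega R)
    (A : online_algorithm R n r Omega) (X : finType) (x : X -> 'I_n -> R)
    (i : nat) (c b rho : R) :
  (0 < #|X|)%N -> (i.*2 <= n)%N -> 0 < c -> 0 <= b ->
  (forall u (p : 'I_n), (p < i.*2)%N -> 0 <= x u p <= b) ->
  (forall w, #|X|%:R * c <= \sum_u matching_cost (x u) (run A w (x u) i)) ->
  competitive P A rho -> c <= rho * b.
Proof.
move=> X0 h c0 b0 xb cost comp.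
have X0' : 0 < #|X|%:R :> R by rewrite ltr0n.
pose E u w := (matching_cost (x u) (run A w (x u) i))%:E.
have E0 u w : (0 <= E u w)%E by rewrite lee_fin matching_cost_ge0.
have mE u : measurable_fun setT (E u).
  apply/measurable_EFinP.
  exact: (measurable_run A (x u) i (matching_cost (x u))).
have le1 : ((#|X|%:R * c)%:E <= \sum_u \int[P]_w E u w)%E.
  rewrite -ge0_integral_sum //.
  have -> : ((#|X|%:R * c)%:E = \int[P]_(w in setT) (cst (#|X|%:R * c)%:E w))%E.
    rewrite integral_cst // [X in (_ * X)%E](_ : _ = 1%E) ?mule1 //.
    exact: probability_setT.
  apply: ge0_le_integral => //.
  - by move=> w _; rewrite lee_fin mulr_ge0 // ltW.
  - exact: emeasurable_sum.
  - by move=> w _; rewrite /E sumEFin lee_fin.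
have le2 : (\sum_u \int[P]_w E u w <= (rho * \sum_u opt_cost (x u) i)%:E)%E.
  rewrite mulr_sumr -sumEFin; apply: lee_sum => u _.
  by have := comp (x u) i h; rewrite unlock.
have := le_trans le1 le2; rewrite lee_fin => le3.
have opt u : 0 <= opt_cost (x u) i <= b by apply: opt_cost_bounds => // p; exact: xb.
have opt0 : 0 <= \sum_u opt_cost (x u) i.
  by apply: sumr_ge0 => u _; case/andP: (opt u).
have optb : \sum_u opt_cost (x u) i <= #|X|%:R * b.
  rewrite mulr_natl -sumr_const; apply: ler_sum => u _.
  by case/andP: (opt u).
(* The sign of [rho] matters for replacing the optimum by its upper bound [b]. *)
have rho0 : 0 < rho.
  rewrite ltNge; apply/negP => rho0.
  have : 0 < #|X|%:R * c by rewrite mulr_gt0.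
  by rewrite ltNge (le_trans le3) // mulr_le0_ge0.
by rewrite -(ler_pM2l X0') (le_trans le3) // mulrCA ler_wpM2l // ltW.
Qed.

(** The average cost is at least [L.+1 * scale L / 32] and the optimum at most [72 * r * scale L];
    the scale cancels, and [2304 = 32 * 72]. The schedule has at most [2 * (32 * r) ^ L] pairs. *)
Lemma ratio_lower_bound (R : realType) (n r L : nat) (d : measure_display)
    (Omega : measurableType d) (P : probability Omega R)
    (A : online_algorithm R n r Omega) (rho : R) :
  (0 < r)%N -> (4 * (32 * r) ^ L <= n)%N ->
  competitive P A rho -> L.+1%:R <= 2304 * rho * r%:R.
Proof.
move=> r0 Ln comp.
have fits : ((phase_start r L L.+1).*2 <= n)%N.
  have := phase_start_end r0 (leq0n L); rewrite /phase_start big_ord0 add0n => h.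
  apply: leq_trans Ln; rewrite -[4%N]/(2 * 2)%N -mulnA mul2n leq_double mul2n.
  by apply: leq_trans h _; rewrite /num_windows subn0.
pose x (u : {ffun 'I_n -> bool}) (k : 'I_n) : R := (position r L u k)%:R.
have S0 : 0 < (scale r L)%:R :> R by rewrite ltr0n scale_gt0.
have rR : 0 < r%:R :> R by rewrite ltr0n.
(* The 32 is 16 from [total_cost_lower_bound] times 2, since its sum over points counts every edge
   twice. *)
have key w : #|{ffun 'I_n -> bool}|%:R * (L.+1%:R * (scale r L)%:R / 32) <=
    \sum_u matching_cost (x u) (run A w (x u) (phase_start r L L.+1)).
  have onl u v i : (forall k : 'I_n, (k < i.*2)%N -> position r L u k = position r L v k) ->
      run A w (x u) i = run A w (x v) i.
    by move=> uv; apply: run_online => k ki; rewrite /x uv.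
  have := total_cost_lower_bound r0 onl (fun u i => @run_perfect _ _ _ _ _ A w (x u) i)
    (fun u i => @run_recourse _ _ _ _ _ A w (x u) i) fits.
  rewrite -(ler_nat R) !natrM natr_sum.
  rewrite (eq_bigr (fun u => matching_cost (x u) (run A w (x u) (phase_start r L L.+1)) *+ 2)).
    by rewrite sumrMnl; set s := bigop _ _ _; move=> h; lra.
  move=> u _; rewrite (matching_cost_mate _ (run_perfect A w (x u) fits)) natr_sum.
  by apply: eq_bigr => p _; rewrite natdistE.
have := competitive_lower_bound (b := (72 * r * scale r L)%:R) _ fits _ _ _ key comp.
rewrite card_ffun card_bool expn_gt0 ler0n => /(_ isT) h.
have {h} : L.+1%:R * (scale r L)%:R / 32 <= rho * (72 * r * scale r L)%:R.
  apply: h => //; first by rewrite divr_gt0 // mulr_gt0 // ltr0n.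
  by move=> u p pT; rewrite ler0n ler_nat position_le.
rewrite !natrM mulrA ler_pdivrMr // => h.
by rewrite -(ler_pM2r S0); lra.
Qed.

Unset Implicit Arguments.
Set Strict Implicit.

Theorem theorem1p7 (R : realType) :
  exists (c : R) (N : nat), 0 < c /\
    forall (n r : nat), (N <= n)%N -> ~~ odd n -> (2 <= r)%N ->
    forall (d : measure_display) (Omega : measurableType d)
      (P : probability Omega R) (A : online_algorithm R n r Omega),
      ((c * (ln n%:R / (r%:R * ln r%:R)))%:E <= competitive_ratio P A)%E.
Proof.
(* Here [18432 = 8 * 2304], with 8 from the bound on [ln n] below; [4 <= n] makes [n %/ 4]
   positive. *)
exists (1 / 18432), 4%N; split; first by lra.
move=> n r n4 _ r2 d Omega P A; apply: le_ereal_inf_tmp => _ [rho comp <-].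
rewrite lee_fin.
have n4' : (0 < n %/ 4)%N by rewrite divn_gt0.
have K1 : (1 < 32 * r)%N by lia.
(* The largest [L] for which [(32 * r) ^ L <= n %/ 4], so that the schedule fits into [n] points. *)
have /andP[Llo Lhi] := trunc_log_bounds K1 n4'.
set L := trunc_log _ _ in Llo Lhi.
rewrite leq_divRL // mulnC in Llo.
have bound := ratio_lower_bound (ltnW r2) Llo comp.
have r1 : 1 < r%:R :> R by rewrite ltr1n.
have lnr : 0 < ln r%:R :> R by rewrite ln_gt0.
have lnn : ln n%:R <= 8 * L.+1%:R * ln r%:R :> R.
  (* By maximality of [L], [n < 4 * (32 * r) ^ L.+1 <= (128 * r) ^ L.+1], and
     [128 = 2 ^ 7 <= r ^ 7]. *)
  have nr : (n <= (r ^ 8) ^ L.+1)%N.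
    have p4 : (4 <= 4 ^ L.+1)%N by rewrite expnS leq_pmulr // expn_gt0.
    rewrite ltn_divLR // mulnC in Lhi; apply: leq_trans (ltnW Lhi) _.
    apply: (@leq_trans ((4 * (32 * r)) ^ L.+1)).
      by rewrite [leqRHS]expnMn leq_mul2r p4 orbT.
    rewrite leq_exp2r // expnS [leqRHS]mulnC mulnA leq_mul2r; apply/orP; right.
    by rewrite -[(4 * 32)%N]/(2 ^ 7)%N leq_exp2r.
  apply: (@le_trans _ _ (ln ((r ^ 8) ^ L.+1)%:R)).
    by rewrite ler_ln ?ler_nat // posrE ltr0n ?(leq_trans _ nr) // (leq_trans _ n4).
  rewrite -expnM natrX lnXn; last by lra.
  by rewrite -[leLHS]mulr_natl natrM.
have rR : 0 < r%:R :> R by lra.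
rewrite mulrA ler_pdivrMr ?mulr_gt0 //.
have := ler_wpM2r (ltW lnr) bound; lra.
Qed.
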